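(* For each integer $n\ge 2$ there exists a probabilistically diffusive function $p_n:\{0,1\}^n\to\{0,1\}^n$. More generally, for each integer $n\ge 2$ and every integer $m\ge n$ there exists a probabilistically diffusive function $\{0,1\}^n\to\{0,1\}^m$, while no such function exists for any positive integer $m<n$.
   Context: For a positive integer $n$, $\{0,1\}^n$ denotes the set of $n$-bit binary strings, with bits indexed from $1$ to $n$ from left to right, and $\oplus$ denotes bitwise XOR (addition modulo 2). $E_n$ denotes the set of unordered pairs $\{x,y\}$ of elements of $\{0,1\}^n$ that differ in exactly one bit (the edges of the $n$-dimensional hypercube); it has $n2^{n-1}$ elements. For $1\le i\le m$, $\pi_i:\{0,1\}^m\to\mathbb{Z}$ sends a string to its $i$-th bit, regarded as the integer $0$ or $1$. A function $p:\{0,1\}^n\to\{0,1\}^m$ is called probabilistically diffusive if it is injective and, for every index $1\le i\le m$, $$\frac{1}{n2^{n-1}}\sum_{\{x,y\}\in E_n}\pi_i\bigl(p(x)\oplus p(y)\bigr)=\frac12 .$$ *)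

(* Defs.v *)
From HB Require Import structures.
From mathcomp Require Import all_boot all_order all_algebra.
Set Implicit Arguments.
Unset Strict Implicit.
Unset Printing Implicit Defensive.
Import GRing.Theory.
Local Open Scope ring_scope.

(* The i-th bit from the left, 1 <= i <= n, is [tnth x] at the
   ordinal with value i.-1. *)
Notation bitstring n := (n.-tuple bool).

Definition bxor (n : nat) (x y : bitstring n) : bitstring n :=
  [tuple tnth x i (+) tnth y i | i < n].

Definition bzero (n : nat) : bitstring n := [tuple false | _ < n].

Definition proj (m : nat) (i : 'I_m) (x : bitstring m) : int :=
  (nat_of_bool (tnth x i))%:Z.

Definition differ_in_one_bit (n : nat) (x y : bitstring n) : bool :=
  #|[set i : 'I_n | tnth x i != tnth y i]| == 1%N.

Definition cube_edges (n : nat) : {set {set bitstring n}} :=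
  [set [set x; y] | x : bitstring n, y : bitstring n in [pred y | differ_in_one_bit x y]].

(* p(x) (+) p(y) as a function of the unordered pair e = {x, y}; see
   [edge_xorE]. *)
Definition edge_xor (n m : nat) (p : bitstring n -> bitstring m)
    (e : {set bitstring n}) : bitstring m :=
  \big[@bxor m/bzero m]_(x in e) p x.

Definition probabilistically_diffusive (n m : nat)
    (p : bitstring n -> bitstring m) : Prop :=
  injective p /\
  forall i : 'I_m,
    ((n * 2 ^ n.-1)%N%:R)^-1
      * \sum_(e in cube_edges n) (proj i (edge_xor p e))%:~R
    = 1 / 2 :> rat.

Lemma bxorA (n : nat) : associative (@bxor n).
Proof. by move=> x y z; apply: eq_from_tnth => i; rewrite !tnth_mktuple addbA. Qed.

Lemma bxorC (n : nat) : commutative (@bxor n).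
Proof. by move=> x y; apply: eq_from_tnth => i; rewrite !tnth_mktuple addbC. Qed.

Lemma bxor0 (n : nat) : left_id (bzero n) (@bxor n).
Proof. by move=> x; apply: eq_from_tnth => i; rewrite !tnth_mktuple. Qed.

HB.instance Definition _ (n : nat) :=
  Monoid.isComLaw.Build (bitstring n) (bzero n) (@bxor n)
    (@bxorA n) (@bxorC n) (@bxor0 n).

Lemma edge_xorE (n m : nat) (p : bitstring n -> bitstring m)
    (x y : bitstring n) :
  differ_in_one_bit x y -> edge_xor p [set x; y] = bxor (p x) (p y).
Proof.
move=> dxy; have nxy : x != y.
  apply: contraTneq dxy => ->; rewrite /differ_in_one_bit.
  by rewrite (_ : [set _ | _] = set0) ?cards0 //; apply/setP=> i; rewrite !inE eqxx.
by rewrite /edge_xor big_setU1 ?inE //= big_set1.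
Qed.

(* Main.v *)
Require Import Defs.
From mathcomp Require Import all_boot all_order all_algebra.
From mathcomp Require Import zify.
Set Implicit Arguments.
Unset Strict Implicit.
Unset Printing Implicit Defensive.
Import GRing.Theory.

(** A coordinate function [f] of a diffusive map has average sensitivity [n / 2].
    If [f] has average sensitivity [n / 2] and [h] is a function of two fresh bits
    which is neither constant nor, up to negation, [a (+) b], then [f x (+) h a b]
    has average sensitivity [n / 2 + 1].  Starting from coordinates [f_0, f_1, ...] on
    [n] bits, use [f_0 (+) (a && ~~ b)], [f_0 (+) (~~ a && b)] and all the
    [f_i (+) (a && b)] on [n + 2] bits: XORing the first two with
    [f_0 (+) (a && b)] gives back [a] and [b], and then every [f_i].  The induction
    starts from the identity for [n = 2] and from three cyclically permuted
    multiplexers for [n = 3].  Codomains of more than [n] bits are filled by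
    repeating coordinates; fewer than [n] bits contradict injectivity. *)

(** * Bit flips, edges of the hypercube and sensitivity *)

Definition flip (n : nat) (i : 'I_n) (x : bitstring n) : bitstring n :=
  [tuple tnth x j (+) (j == i) | j < n].

Lemma differ_flip (n : nat) (i : 'I_n) (x : bitstring n) :
  differ_in_one_bit x (flip i x).
Proof.
rewrite /differ_in_one_bit (_ : [set _ | _] = [set i]) ?cards1 //.
apply/setP=> j; rewrite !inE tnth_mktuple.
by case: (j == i); case: (tnth x j).
Qed.

Lemma differ_in_one_bitP (n : nat) (x y : bitstring n) :
  reflect (exists i, y = flip i x) (differ_in_one_bit x y).
Proof.
apply: (iffP idP) => [/cards1P[i xyi]|[i ->]]; last exact: differ_flip.
exists i; apply: eq_from_tnth => j; rewrite tnth_mktuple.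
by move/setP/(_ j): xyi; rewrite !inE => <-; case: (tnth x j); case: (tnth y j).
Qed.

Lemma flip_neq (n : nat) (i : 'I_n) (x : bitstring n) : x != flip i x.
Proof.
apply/eqP => /(congr1 (fun z => tnth z i)).
by rewrite tnth_mktuple eqxx; case: (tnth x i).
Qed.

Lemma flipK (n : nat) (i : 'I_n) : involutive (flip i).
Proof. by move=> x; apply: eq_from_tnth => j; rewrite !tnth_mktuple addbK. Qed.

Lemma flip_inj_index (n : nat) (x : bitstring n) : injective (fun i => flip i x).
Proof.
move=> i j /(congr1 (fun z => tnth z i)); rewrite !tnth_mktuple eqxx.
by case: eqP => //; case: (tnth x i).
Qed.

Lemma cube_edgesP (n : nat) (e : {set bitstring n}) :
  reflect (exists x i, e = [set x; flip i x]) (e \in cube_edges n).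
Proof.
apply: (iffP imset2P) => [[x y _]|[x [i ->]]].
  by rewrite !inE => /differ_in_one_bitP[i ->] ->; exists x, i.
by exists x (flip i x); rewrite ?inE ?differ_flip.
Qed.

Lemma edges_at (n : nat) (x : bitstring n) :
  [set e in cube_edges n | x \in e] = [set [set x; flip i x] | i : 'I_n].
Proof.
apply/setP=> e; rewrite !inE; apply/andP/imsetP => [[]|[i _ ->]].
  case/cube_edgesP=> y [i ->]; rewrite !inE => /orP[]/eqP->; exists i => //.
  by rewrite flipK setUC.
by split; [apply/cube_edgesP; exists x, i | rewrite !inE eqxx].
Qed.

(** Double counting of incidences: an edge has two ends, and the edges at [x] correspond to the bits
    of [x] that can be flipped. *)
Lemma sum_cube_edges (n : nat) (F : {set bitstring n} -> nat) :
  (\sum_(e in cube_edges n) F e) * 2 =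
  \sum_(x : bitstring n) \sum_(i < n) F [set x; flip i x].
Proof.
transitivity (\sum_(e in cube_edges n) \sum_(x in e) F e).
  rewrite big_distrl /=; apply: eq_bigr => e /cube_edgesP[x [i ->]].
  by rewrite sum_nat_const cards2 flip_neq mulnC.
rewrite (exchange_big_dep predT) //=; apply: eq_bigr => x _.
transitivity (\sum_(e in [set e in cube_edges n | x \in e]) F e).
  by apply: eq_bigl => e; rewrite inE.
rewrite edges_at big_imset //= => i j _ _ eij.
(* Distinct directions give distinct edges: [flip i x] lies on the second edge and is not [x], so it
   is [flip j x]. *)
apply: (@flip_inj_index _ x); move/setP/(_ (flip i x)): eij.
by rewrite !inE eqxx orbT eq_sym (negPf (flip_neq i x)) /= => /esym/eqP.
Qed.

(** Each edge is counted from both ends, so this is [2 ^ n] times the average sensitivity (total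
    influence) of [f]. *)
Definition sensitivity (n : nat) (f : bitstring n -> bool) : nat :=
  \sum_(x : bitstring n) \sum_(i < n) (f x (+) f (flip i x)).

Lemma eq_sensitivity (n : nat) (f g : bitstring n -> bool) :
  f =1 g -> sensitivity f = sensitivity g.
Proof.
by move=> fg; apply: eq_bigr => x _; apply: eq_bigr => i _; rewrite !fg.
Qed.

Lemma sensitivity_addb (n : nat) (f : bitstring n -> bool) (b : bool) :
  sensitivity (fun x => f x (+) b) = sensitivity f.
Proof.
apply: eq_bigr => x _; apply: eq_bigr => i _.
by case: b; case: (f x); case: (f _).
Qed.

Lemma sum_bitstring0 (F : bitstring 0 -> nat) :
  \sum_(x : bitstring 0) F x = F [tuple].
Proof. by rewrite (big_pred1 [tuple]) // => x; apply/esym/eqP/tuple0. Qed.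

Lemma sum_bitstringS (n : nat) (F : bitstring n.+1 -> nat) :
  \sum_(x : bitstring n.+1) F x =
  \sum_(x : bitstring n) F (cons_tuple false x) +
  \sum_(x : bitstring n) F (cons_tuple true x).
Proof.
rewrite (reindex (fun bx : bool * bitstring n => cons_tuple bx.1 bx.2)) /=.
  by rewrite -(pair_bigA _ (fun b x => F (cons_tuple b x))) big_bool addnC.
exists (fun x => (thead x, behead_tuple x)) => [[b x]|x] _ /=.
  by congr pair; apply: val_inj.
by rewrite [RHS]tuple_eta; apply: val_inj.
Qed.

Lemma flip_cons0 (n : nat) (b : bool) (x : bitstring n) :
  flip ord0 (cons_tuple b x) = cons_tuple (~~ b) x.
Proof.
apply: eq_from_tnth => j; rewrite tnth_mktuple.
by case: (unliftP ord0 j) => [k|] ->; rewrite ?tnthS ?tnth0 ?addbT ?addbF.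
Qed.

Lemma flip_consS (n : nat) (i : 'I_n) (b : bool) (x : bitstring n) :
  flip (lift ord0 i) (cons_tuple b x) = cons_tuple b (flip i x).
Proof.
apply: eq_from_tnth => j; rewrite tnth_mktuple.
case: (unliftP ord0 j) => [k|] ->; rewrite ?tnthS ?tnth0 ?addbF //.
by rewrite tnth_mktuple (inj_eq lift_inj).
Qed.

Lemma sensitivity0 (f : bitstring 0 -> bool) : sensitivity f = 0.
Proof. by apply: big1 => x _; rewrite big_ord0. Qed.

(** Edges either stay inside one of the two subcubes fixed by the head bit or cross between them;
    the crossing ones are seen from both ends, whence the factor 2. *)
Lemma sensitivityS (n : nat) (f : bitstring n.+1 -> bool) :
  sensitivity f =
  sensitivity (fun x => f (cons_tuple false x)) +
  sensitivity (fun x => f (cons_tuple true x)) +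
  (\sum_(x : bitstring n) (f (cons_tuple false x) (+) f (cons_tuple true x))) * 2.
Proof.
have half b : \sum_(x : bitstring n) \sum_(i < n.+1)
    (f (cons_tuple b x) (+) f (flip i (cons_tuple b x))) =
    \sum_(x : bitstring n) (f (cons_tuple false x) (+) f (cons_tuple true x)) +
    sensitivity (fun x => f (cons_tuple b x)).
  rewrite -big_split /=; apply: eq_bigr => x _.
  rewrite big_ord_recl flip_cons0; congr (_ + _); first by case: b; rewrite //= addbC.
  by apply: eq_bigr => i _; rewrite flip_consS.
by rewrite /sensitivity sum_bitstringS !half muln2 -addnn addnACA addnC.
Qed.

(** * Half-sensitive functions and families separating points *)

Definition half_sensitive (n : nat) (f : bitstring n -> bool) : Prop :=
  sensitivity f * 2 = n * 2 ^ n.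

(** On each of the four subcubes fixing [a] and [b], [g] is [f] up to negation. In the two new
    directions [f] cancels and only [h] matters; it changes along two of the four sides of the
    square. The total is [4 * sensitivity f + 4 * 2 ^ n]. *)
Lemma half_sensitive_addb2 (n : nat) (f : bitstring n -> bool)
    (h : bool -> bool -> bool) (g : bitstring n.+2 -> bool) :
  (forall a b x, g (cons_tuple a (cons_tuple b x)) = f x (+) h a b) ->
  (h false false (+) h false true) + (h true false (+) h true true) +
  (h false false (+) h true false) + (h false true (+) h true true) = 2 ->
  half_sensitive f -> half_sensitive g.
Proof.
move=> gE h2 f_half; rewrite /half_sensitive !sensitivityS.
have restr a b : sensitivity (fun x => g (cons_tuple a (cons_tuple b x)))
    = sensitivity f.
  by rewrite (eq_sensitivity (gE a b)) sensitivity_addb.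
have cross a b a' b' : \sum_(x : bitstring n)
   (g (cons_tuple a (cons_tuple b x)) (+) g (cons_tuple a' (cons_tuple b' x)))
   = 2 ^ n * (h a b (+) h a' b').
  under eq_bigr => x _ do rewrite !gE addbACA addbb addFb.
  by rewrite sum_nat_const card_tuple card_bool.
rewrite !restr sum_bitstringS !cross.
move: f_half h2; rewrite /half_sensitive !expnS.
set s := sensitivity f; set N := 2 ^ n.
move: (nat_of_bool _) (nat_of_bool _) (nat_of_bool _) (nat_of_bool _) => p q r t.
by move=> sN pqrt; nia.
Qed.

(** The family is indexed by all of [nat] to serve every codomain of at least [n] bits, but its
    first [n] members must already separate points. *)
Definition separating (n : nat) (f : nat -> bitstring n -> bool) : Prop :=
  forall x y, (forall i, i < n -> f i x = f i y) -> x = y.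

Definition mux (a b c : bool) : bool := if a then b else c.

Lemma half_sensitive_family2 :
  exists f : nat -> bitstring 2 -> bool,
    (forall i, half_sensitive (f i)) /\ separating f.
Proof.
(* The boolean [i != 0] is read as a position: bit 0 for [i = 0], bit 1 for all later [i]. A single
   bit has average sensitivity 1, half of 2. *)
exists (fun i x => nth false x (i != 0)); split=> [i|x y xy].
  by rewrite /half_sensitive !(sensitivityS, sensitivity0, sum_bitstringS,
    sum_bitstring0); case: i.
apply/val_inj/(@eq_from_nth _ false) => [|[|[|i]]]; rewrite !size_tuple //.
  exact: (xy 0).
exact: (xy 1).
Qed.

(** Affine functions have integral average sensitivity, so 3/2 calls for a nonlinear one. The three
    multiplexers together preserve Hamming weight, rotating strings of weight 1 to the right and
    those of weight 2 to the left, hence a bijection. *)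
Lemma half_sensitive_family3 :
  exists f : nat -> bitstring 3 -> bool,
    (forall i, half_sensitive (f i)) /\ separating f.
Proof.
pose f (i : nat) (x : bitstring 3) := let b := nth false x in
  match i with
  | 0 => mux (b 0) (b 1) (b 2)
  | 1 => mux (b 1) (b 2) (b 0)
  | _ => mux (b 2) (b 0) (b 1)
  end.
exists f; split=> [i|x y xy].
  by rewrite /half_sensitive !(sensitivityS, sensitivity0, sum_bitstringS,
    sum_bitstring0); case: i => [|[|i]].
move: (xy 0 isT) (xy 1 isT) (xy 2 isT); rewrite /f.
case: x y {xy} => [[|a [|b [|c []]]] // hx] [[|a' [|b' [|c' []]]] // hy] /=.
move=> h0 h1 h2; apply: val_inj => /=; move: h0 h1 h2.
by case: a b c a' b' c' {hx hy} => [] [] [] [] [] [].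
Qed.

Lemma half_sensitive_family_step (n : nat) :
  0 < n ->
  (exists f : nat -> bitstring n -> bool,
    (forall i, half_sensitive (f i)) /\ separating f) ->
  exists f : nat -> bitstring n.+2 -> bool,
    (forall i, half_sensitive (f i)) /\ separating f.
Proof.
move=> n_gt0 [f [f_half f_sep]].
pose tail2 (x : bitstring n.+2) : bitstring n := behead_tuple (behead_tuple x).
pose h (i : nat) a b := match i with
  | 0 => a && ~~ b | 1 => ~~ a && b | _ => a && b end.
(* Truncated subtraction gives [g 0], [g 1] and [g 2] the same summand [f 0]. *)
pose g i (x : bitstring n.+2) :=
  f (i - 2) (tail2 x) (+) h i (nth false x 0) (nth false x 1).
have gE i a b x : g i (cons_tuple a (cons_tuple b x)) = f (i - 2) x (+) h i a b.
  by rewrite /g; congr (f _ _ (+) _); apply: val_inj.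
exists g; split=> [i|x y].
  by apply: (half_sensitive_addb2 (gE i)) => //; case: i => [|[|i]].
have cons2 (z : bitstring n.+2) : exists a b t, z = cons_tuple a (cons_tuple b t).
  exists (thead z), (thead (behead_tuple z)), (tail2 z).
  by case: z => [[|a [|b s]]] // hz; apply: val_inj.
have [a [b [t ->]]] := cons2 x; have [a' [b' [t' ->]]] := cons2 y.
move=> xy; have [xy0 xy1 xy2] := And3 (xy 0 isT) (xy 1 isT) (xy 2 n_gt0).
have [ea eb] : a = a' /\ b = b'.
  move: xy0 xy1 xy2; rewrite !gE !subnn /=.
  (* At most one of the three [h] values is true, so two such triples are never complementary:
     [f 0 t] and [f 0 t'] agree, and the triple determines [a] and [b]. *)
  by move: (f 0 t) (f 0 t') => [] []; case: a b a' b' {xy} => [] [] [] [].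
subst a' b'; congr (cons_tuple a (cons_tuple b _)).
apply: f_sep => i i_lt_n; have := xy i.+2 i_lt_n.
by rewrite !gE subSS subn1 /= => /addIb.
Qed.

Lemma half_sensitive_family (n : nat) : 2 <= n ->
  exists f : nat -> bitstring n -> bool,
    (forall i, half_sensitive (f i)) /\ separating f.
Proof.
elim/ltn_ind: n => -[|[|[|[|n]]]] // IH _.
- exact: half_sensitive_family2.
- exact: half_sensitive_family3.
- by apply: half_sensitive_family_step => //; apply: IH.
Qed.

(** * From half-sensitive families to diffusive maps *)

Lemma edge_average (n m : nat) (p : bitstring n -> bitstring m) (i : 'I_m) :
  0 < n -> half_sensitive (fun x => tnth (p x) i) ->
  (((n * 2 ^ n.-1)%N%:R)^-1
      * \sum_(e in cube_edges n) (proj i (edge_xor p e))%:~R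
    = 1 / 2 :> rat)%R.
Proof.
move=> n_gt0 half; pose S := \sum_(e in cube_edges n) tnth (edge_xor p e) i.
have SE : S * 2 = n * 2 ^ n.-1.
  rewrite /S sum_cube_edges; apply/eqP; rewrite -(eqn_pmul2r (isT : 0 < 2)).
  rewrite -mulnA -expnSr prednK // -half; apply/eqP; congr (_ * _).
  apply: eq_bigr => x _; apply: eq_bigr => j _.
  by rewrite edge_xorE ?differ_flip // tnth_mktuple.
have -> : (\sum_(e in cube_edges n) (proj i (edge_xor p e))%:~R = S%:R :> rat)%R.
  by rewrite /S natr_sum.
(* The normalising factor will be rewritten as [S * 2], and [S] then cancelled. *)
have S_neq0 : (S%:R != 0 :> rat)%R.
  rewrite Num.Theory.pnatr_eq0 -lt0n -(ltn_pmul2r (isT : 0 < 2)) SE.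
  by rewrite muln_gt0 n_gt0 expn_gt0.
by rewrite -SE natrM invfM mulrAC mulVf.
Qed.

Lemma probabilistically_diffusive_exists (n m : nat) :
  2 <= n -> n <= m ->
  exists p : bitstring n -> bitstring m, probabilistically_diffusive p.
Proof.
move=> n_ge2 n_le_m; have [f [f_half f_sep]] := half_sensitive_family n_ge2.
exists (fun x => [tuple f i x | i < m]); split=> [x y pxy|i].
  apply: f_sep => i i_lt_n.
  have := congr1 (fun z => tnth z (Ordinal (leq_trans i_lt_n n_le_m))) pxy.
  by rewrite !tnth_mktuple.
apply: edge_average; first exact: ltnW.
rewrite /half_sensitive -(f_half i); congr (_ * _).
by apply: eq_sensitivity => x; rewrite tnth_mktuple.
Qed.

Lemma bitstring_inj_leq (n m : nat) (p : bitstring n -> bitstring m) :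
  injective p -> n <= m.
Proof. by move/leq_card; rewrite !card_tuple card_bool leq_exp2l. Qed.

Theorem theorem8 :
  (forall n : nat, (2 <= n)%N ->
     exists p : bitstring n -> bitstring n, probabilistically_diffusive p)
  /\
  (forall n : nat, (2 <= n)%N ->
     (forall m : nat, (n <= m)%N ->
        exists p : bitstring n -> bitstring m, probabilistically_diffusive p)
     /\
     (forall m : nat, (0 < m)%N -> (m < n)%N ->
        ~ exists p : bitstring n -> bitstring m, probabilistically_diffusive p)).
Proof.
split=> [n n_ge2|n n_ge2]; first exact: probabilistically_diffusive_exists.
split=> [m|m _ m_lt_n [p [p_inj _]]]; first exact: probabilistically_diffusive_exists.
by move: (bitstring_inj_leq p_inj); rewrite leqNgt m_lt_n.
Qed.
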